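(* Let $c>2\sqrt{\log 2}$ be a real number. For any irrational $\alpha\in\mathbb{R}$ and for any $\gamma\in\mathbb{R}$ there are infinitely many pairs of coprime integers $m,n$ with $n\neq 0$ such that $$\left|n\alpha-m-\gamma\right|\le\frac{\exp\left(c\sqrt{\log |n|}\right)}{|n|}.$$
   Context: Here $\log$ is the natural logarithm. Integers $m,n$ (of any sign) are coprime if $\gcd(m,n)=1$. *)

(* Defs.v *)
From mathcomp Require Export all_boot all_order all_algebra.
From mathcomp Require Export all_classical all_reals all_analysis.

(* Main.v *)
Require Import Defs.
From mathcomp Require Import zify ring lra.
Import Order.TTheory GRing.Theory Num.Theory.
Import numFieldNormedType.Exports.
Local Open Scope classical_set_scope.
Local Open Scope ring_scope.

(** The error reached below is of order [(log n) ^ 2 / n], which is eventually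
    smaller than [exp (c * sqrt (log n)) / n].

    Take a fraction [p / q] with [|q alpha - p| <= 1 / q], and complete [(q, p)]
    to a basis of the integer lattice with a vector [(u, v)] such that
    [v q - u p = 1] and [0 <= u < q].  In the coordinates
    [(n, m) = t (q, p) - r (u, v)] one has [n p - m q = r], hence
      [n alpha - m - gamma = (n (q alpha - p) + (r - q gamma)) / q].
    This is [O(H / q)] as soon as [n] is at most of order [H q] and [r] is
    within [H] of [q gamma], which leaves [r] and [t] free in a pair of
    intervals of length [H] ([coprime_solution_of_size]).  The change of basis
    being unimodular, [m] and [n] are coprime exactly when [r] and [t] are.

    It remains to find a coprime pair in an [H] by [H] square of integers whose
    first coordinates are below [2 ^ L], where [H] is linear in [L]
    ([exists_coprime_in_square]).  The pairs sharing a factor [2] or an odd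
    factor at least [3] and at most [H] make up, to first order, a proportion
    at most [1 / 4 + 1 / 9 + 1 / 25 + ... < 1 / 2].  A prime larger than [H]
    divides at most one integer of an interval of length [H], and each [r] has
    at most [L] prime factors, so large primes spoil at most [H L] pairs.

    With [L] of order [log q], and [n] between [q] and a multiple of [H q], the
    error [O(H / q)] is [O((log n) ^ 2 / n)].  Letting [q] grow gives infinitely
    many pairs, and a negative [gamma] is reduced to a positive one by changing
    the signs of [alpha], [gamma] and [m]. *)

(** * Coprime pairs in a square *)

Lemma sum_dvdn_shift_le (H a d : nat) :
  (0 < d)%N -> (\sum_(i < H) (d %| a + i) <= (H %/ d).+1)%N.
Proof.
move=> d_gt0; rewrite -big_mkcond sum1_card /=.
have div_bound (i : 'I_H) : (i %/ d < (H %/ d).+1)%N.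
  by rewrite ltnS leq_div2r // ltnW.
pose f (i : 'I_H) := Ordinal (div_bound i).
rewrite -[X in (_ <= X)%N]card_ord -(card_in_image (f := f)) ?max_card //.
move=> i j; rewrite !unfold_in => di dj [eq_div]; apply: val_inj => /=.
have eq_mod : (i = j %[mod d])%N.
  apply/eqP; rewrite -(eqn_modDl a); move: di dj.
  by rewrite /dvdn => /eqP-> /eqP->.
by rewrite (divn_eq i d) (divn_eq j d) eq_div eq_mod.
Qed.

(** Since [(x + 1) ^ 2 <= 3 / 2 * x ^ 2 + 3], which trades the cross term [2 x]
    for a slightly worse leading constant, it suffices to bound the sum of
    [1 / (2 k + 3) ^ 2].  This telescopes, because
    [(2 k + 3) ^ 2 >= 4 (k + 1) (k + 2)]. *)
Lemma sum_sqr_divn_odd_le (H K : nat) :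
  (\sum_(k < K) (H %/ (k.*2 + 3)).+1 ^ 2)%:R
    <= 3 / 8 * H%:R ^+ 2 * (1 - K.+1%:R^-1) + 3 * K%:R :> rat.
Proof.
elim: K => [|K IHK]; first by rewrite big_ord0 invr1 subrr !mulr0 add0r.
rewrite big_ord_recr /= natrD.
have := leq_trunc_div H (K.*2 + 3); move: (H %/ _)%N => x.
rewrite -(ler_nat rat) natrM natrD -muln2 natrM => x_le.
have step : (x.+1 ^ 2)%:R
    <= 3 / 8 * H%:R ^+ 2 * (K.+1%:R^-1 - K.+2%:R^-1) + 3 :> rat.
  rewrite natrX -[x.+1%:R]natr1.
  have K_ge0 : 0 <= K%:R :> rat by [].
  have -> : K.+1%:R^-1 - K.+2%:R^-1 = ((K%:R + 1) * (K%:R + 2))^-1 :> rat.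
    by rewrite -[K.+2]addn2 -[K.+1]addn1 !natrD; field; apply/andP; split; lra.
  have x2_le : x%:R ^+ 2 <= H%:R ^+ 2 / 4 / ((K%:R + 1) * (K%:R + 2)) :> rat.
    rewrite ler_pdivlMr ?mulr_gt0 ?ltr_wpDl // ler_pdivlMr //.
    have x_ge0 : 0 <= x%:R :> rat by [].
    have : (x%:R * (K%:R * 2 + 3)) ^+ 2 <= H%:R ^+ 2 :> rat.
      by rewrite ler_pXn2r ?nnegrE // mulr_ge0 ?addr_ge0 ?mulr_ge0.
    have := sqr_ge0 (x%:R : rat); nra.
  have := sqr_ge0 (x%:R - 2 : rat); lra.
have -> : 3 * K.+1%:R = 3 * K%:R + 3 :> rat by rewrite -natr1; ring.
move: step IHK; set s := (\sum_(_ < _) _); set y := K.+1%:R^-1.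
by set z := K.+2%:R^-1; set w := (x.+1 ^ 2)%N; set h := _ ^+ 2; lra.
Qed.

Lemma size_primes_le (L n : nat) :
  (0 < n)%N -> (n <= 2 ^ L)%N -> (size (primes n) <= L)%N.
Proof.
move=> n_gt0 n_le; rewrite -(@leq_exp2l 2) //; apply: leq_trans n_le.
rewrite {2}(prod_prime_decomp n_gt0) prime_decompE big_map /=.
rewrite -sum1_size expn_sum big_seq [X in (_ <= X)%N]big_seq.
apply: leq_prod => p; rewrite mem_primes => /and3P[p_prime _ p_dvd].
rewrite expn1 (leq_trans (prime_gt1 p_prime)) // -[X in (X <= _)%N]expn1.
by rewrite leq_exp2l ?prime_gt1 // logn_gt0 mem_primes p_prime n_gt0.
Qed.

(** If every pair had a common prime factor, counting the [H ^ 2] pairs by such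
    a factor would give
    [H ^ 2 <= 3 / 4 * H ^ 2 + 3 * H + 3 + H * L]: divisors at most [H] account
    for the first three terms, larger primes for the last.  The value
    [H = 4 L + 13] is chosen to contradict this.  Positivity of [a] matters: a
    row with [a + i = 0] would be divisible by every prime. *)
Lemma exists_coprime_in_square (L a b : nat) (H := (4 * L + 13)%N) :
  (0 < a)%N -> (a + H <= 2 ^ L)%N ->
  exists i j, [/\ (i < H)%N, (j < H)%N & coprime (a + i) (b + j)].
Proof.
have L_def : L%:R = (H%:R - 13) / 4 :> rat by rewrite /H natrD natrM; field.
have H_ge : 13 <= H%:R :> rat by rewrite (ler_nat _ 13) /H leq_addl.
clearbody H => a_gt0 aH_le.
have [/existsP[i /existsP[j co_ij]]|no_coprime] :=
  boolP [exists i : 'I_H, [exists j : 'I_H, coprime (a + i) (b + j)]].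
  by exists i, j; split.
have not_coprime (i j : 'I_H) : ~~ coprime (a + i) (b + j).
  apply: contra no_coprime => co_ij.
  by apply/existsP; exists i; apply/existsP; exists j.
(* Summing over all odd numbers instead of odd primes costs little, and makes
   the sum explicit. *)
pose D := 2 :: [seq (k.*2 + 3)%N | k <- index_iota 0 H].
pose common d (i j : 'I_H) := ((d %| a + i) * (d %| b + j))%N.
have covered (i j : 'I_H) : (1 <= \sum_(d <- D) common d i j
    + \sum_(p <- primes (a + i) | H < p) (p %| b + j))%N.
  set p := pdiv (gcdn (a + i) (b + j)).
  have ai_gt0 : (0 < a + i)%N by rewrite addn_gt0 a_gt0.
  have p_prime : prime p.
    apply: pdiv_prime; rewrite ltn_neqAle eq_sym not_coprime gcdn_gt0 ai_gt0 //.
  have := pdiv_dvd (gcdn (a + i) (b + j)); rewrite -/p dvdn_gcd => /andP[pa pb].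
  have [p_large|p_small] := ltnP H p.
    have p_in : p \in primes (a + i) by rewrite mem_primes p_prime ai_gt0.
    by rewrite (big_rem _ p_in) /= p_large pb addnCA leq_addr.
  have p_in : p \in D.
    have [->|p_odd] := even_prime p_prime; first exact: mem_head.
    rewrite inE; apply/orP; right; apply/mapP; exists (p - 3)./2.
      by rewrite mem_index_iota; have := prime_gt1 p_prime; lia.
    by have := prime_gt1 p_prime; lia.
  by rewrite (big_rem _ p_in) /= /common pa pb -addnA leq_addr.
have sum_small : (\sum_(i < H) \sum_(j < H) \sum_(d <- D) common d i j
    <= \sum_(d <- D) (H %/ d).+1 ^ 2)%N.
  apply: (@leq_trans (\sum_(d <- D) \sum_(i < H) \sum_(j < H) common d i j)%N).
    rewrite [X in (_ <= X)%N]exchange_big /=; apply: leq_sum => i _.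
    by rewrite exchange_big.
  rewrite big_seq [X in (_ <= X)%N]big_seq.
  apply: leq_sum => d dD; have d_gt0 : (0 < d)%N.
    by move: dD; rewrite inE => /orP[/eqP->|/mapP[k _ ->]] //; rewrite addn3.
  under eq_bigr => i _ do rewrite -big_distrr /=.
  rewrite -big_distrl /= -mulnn.
  by rewrite leq_mul // sum_dvdn_shift_le.
have sum_large : (\sum_(i < H) \sum_(j < H)
    \sum_(p <- primes (a + i) | H < p) (p %| b + j) <= H * L)%N.
  rewrite -[X in (_ <= X * _)%N]card_ord -sum_nat_const; apply: leq_sum => i _.
  rewrite exchange_big /=.
  apply: (@leq_trans (\sum_(p <- primes (a + i) | H < p) 1)%N).
    apply: leq_sum => p p_large.
    have := sum_dvdn_shift_le H b p (leq_ltn_trans (leq0n H) p_large).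
    by rewrite divn_small.
  rewrite sum1_count (leq_trans (count_size _ _)) //.
  apply: size_primes_le; first by rewrite addn_gt0 a_gt0.
  by rewrite (leq_trans _ aH_le) // leq_add2l ltnW.
have sum_all : (H * H <= \sum_(d <- D) (H %/ d).+1 ^ 2 + H * L)%N.
  apply: leq_trans (leq_add sum_small sum_large).
  rewrite -big_split /= -{1}[H]card_ord -sum_nat_const; apply: leq_sum => i _.
  rewrite -big_split /= -{1}[H]card_ord -sum1_card; apply: leq_sum => j _.
  exact: covered.
have sum_odd := sum_sqr_divn_odd_le H H.
have sqr_two : ((H %/ 2).+1 ^ 2)%:R <= 3 / 8 * H%:R ^+ 2 + 3 :> rat.
  have := leq_trunc_div H 2; move: (H %/ _)%N => x.
  rewrite -(ler_nat rat) natrM natrX -[x.+1%:R]natr1 => x_le.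
  have x2_le : (x%:R * 2) ^+ 2 <= H%:R ^+ 2 :> rat.
    by rewrite ler_pXn2r ?nnegrE // mulr_ge0.
  have := sqr_ge0 (x%:R - 2 : rat); lra.
have inv_ge0 : 0 <= H.+1%:R^-1 :> rat by rewrite invr_ge0.
move: sum_all; rewrite big_cons big_map big_mkord.
move: sum_odd sqr_two; move: (\sum_(_ < _) _)%N ((H %/ 2).+1 ^ 2)%N => s w.
rewrite -(ler_nat rat) !natrD !natrM.
move: inv_ge0; rewrite L_def; move: (H.+1%:R^-1) => y y_ge0.
move: (H%:R : rat) (w%:R : rat) (s%:R : rat) H_ge => h w' s' h_ge s_le w_le hh_le.
have hy_ge0 : 0 <= h ^+ 2 * y by rewrite mulr_ge0 ?sqr_ge0.
by exfalso; lra.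
Qed.

(** * Rational approximation of an irrational number *)

Lemma irrational_neq_frac (R : realType) (alpha : R) (n : nat) (m : int) :
  irrational alpha -> (0 < n)%N -> n%:R * alpha != m%:~R.
Proof.
move=> irr n_gt0; apply/eqP => eq_m; apply: irr; exists (m%:~R / n%:R) => //.
rewrite fmorph_div rmorph_int rmorph_nat -eq_m mulrAC divff ?mul1r //.
by rewrite pnatr_eq0 -lt0n.
Qed.

(** The mediant [(a + c) / (b + d)] of two Farey neighbours differs from
    [alpha], and replacing the neighbour on its side by it keeps the
    determinant equal to [1] while increasing [b + d]. *)
Lemma farey_neighbours (R : realType) (alpha : R) (N : nat) :
  irrational alpha ->
  exists (a c : int) (b d : nat),
    [/\ (0 < b)%N, (0 < d)%N & (N < b + d)%N] /\
    [/\ c * b%:Z - a * d%:Z = 1, a%:~R < b%:R * alpha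
      & d%:R * alpha < c%:~R].
Proof.
move=> irr; elim: N => [|N [a [c [b [d [[b_gt0 d_gt0 N_lt] [det lt_b lt_d]]]]]]].
  exists (Num.floor alpha), (Num.floor alpha + 1), 1%N, 1%N; split=> //.
  have /andP[fl_le fl_lt] := floor_itv alpha.
  split; rewrite ?mul1r //; first by ring.
  rewrite lt_neqAle fl_le andbT eq_sym -[alpha]mul1r.
  exact: (irrational_neq_frac _ _ 1).
have bd_gt0 : (0 < b + d)%N by rewrite addn_gt0 b_gt0.
have := irrational_neq_frac _ _ _ (a + c) irr bd_gt0.
rewrite neq_lt => /orP[lt_med|gt_med].
  exists a, (a + c), b, (b + d)%N; split; first by split=> //; lia.
  by split=> //; rewrite -det PoszD; ring.
exists (a + c), c, (b + d)%N, d; split; first by split=> //; lia.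
by split=> //; rewrite -det PoszD; ring.
Qed.

Lemma dist_int_lower_bound (R : realType) (alpha : R) (Q : nat) :
  irrational alpha ->
  exists2 delta : R, 0 < delta & forall (q : nat) (m : int),
    (0 < q <= Q)%N -> delta <= `|q%:R * alpha - m%:~R|.
Proof.
move=> irr; elim: Q => [|Q [delta delta_gt0 IHQ]].
  by exists 1 => // -[|q].
pose x := Q.+1%:R * alpha; pose f := Num.floor x.
have /andP[fl_le fl_lt] : f%:~R <= x < (f + 1)%:~R := floor_itv x.
have f_lt : f%:~R < x.
  by rewrite lt_neqAle fl_le andbT eq_sym irrational_neq_frac.
exists (Num.min delta (Num.min (x - f%:~R) ((f + 1)%:~R - x))).
  by rewrite !lt_min delta_gt0 !subr_gt0 f_lt.
move=> q m /andP[q_gt0]; rewrite leq_eqVlt !ge_min => /orP[/eqP->|q_le].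
  apply/orP; right; rewrite -/x; have [m_le|m_gt] := lerP m f.
    have m_leR : m%:~R <= f%:~R :> R by rewrite ler_int.
    by rewrite ger0_norm ?lerD2l ?lerN2 ?m_leR // subr_ge0 (le_trans m_leR).
  have m_geR : (f + 1)%:~R <= m%:~R :> R by rewrite ler_int lezD1.
  rewrite distrC ger0_norm ?lerD2r ?m_geR ?orbT // subr_ge0.
  exact/ltW/(lt_le_trans fl_lt).
by rewrite IHQ // q_gt0.
Qed.

(** For Farey neighbours [a / b < alpha < c / d], the positive numbers
    [(b alpha - a) d] and [(c - d alpha) b] add up to the determinant [1].  So
    the neighbour with the smaller denominator [q] satisfies
    [|q alpha - p| < 1 / max b d].  This is at most [1 / q]; it also tends to [0]
    as [b + d] grows, so that [q] itself must grow, multiples of [alpha] by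
    bounded integers staying away from the integers.  The other neighbour
    provides the complementary lattice vector. *)
Lemma unimodular_approximation (R : realType) (alpha : R) (N : nat) :
  irrational alpha ->
  exists (p v : int) (q u : nat), [/\ (N < q)%N, (u < q)%N,
    v * q%:Z - u%:Z * p = 1 & `|q%:R * alpha - p%:~R| <= q%:R^-1].
Proof.
move=> irr.
suff [p [v [u [q [N_lt det close]]]]] : exists (p v u : int) (q : nat),
    [/\ (N < q)%N, v * q%:Z - u * p = 1
       & `|q%:R * alpha - p%:~R| <= q%:R^-1].
  have q_gt0 : (0 < q)%N by apply: leq_ltn_trans N_lt.
  have [u' u'E] : exists u' : nat, u'%:Z = (u %% q%:Z)%Z.
    exists `|(u %% q%:Z)%Z|%N; rewrite gez0_abs // modz_ge0 //; lia.
  (* Adding a multiple of (q, p) to (u, v) brings u into the range [0, q). *)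
  exists p, (v - (u %/ q%:Z)%Z * p), q, u'; split=> //.
    by rewrite -ltz_nat u'E ltz_pmod //; lia.
  by rewrite u'E -det {3}(divz_eq u q%:Z); ring.
have [delta delta_gt0 far] := dist_int_lower_bound _ _ N irr.
have [a [c [b [d [[b_gt0 d_gt0 bd_gt] [det lt_b lt_d]]]]]] :=
  farey_neighbours _ _ (Num.truncn (2 / delta)) irr.
have bd_large : 2 < delta * (b%:R + d%:R).
  rewrite mulrC -ltr_pdivrMr // -natrD.
  by apply: lt_le_trans (truncnS_gt _) _; rewrite ler_nat.
have b_gt0R : 0 < b%:R :> R by rewrite ltr0n.
have d_gt0R : 0 < d%:R :> R by rewrite ltr0n.
have detR : c%:~R * b%:R - a%:~R * d%:R = 1 :> R.
  by have /(congr1 (fun z : int => z%:~R : R)) := det; rewrite rmorphB !rmorphM.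
have near_b : (b%:R * alpha - a%:~R) * d%:R < 1.
  have : 0 < (c%:~R - d%:R * alpha) * b%:R by rewrite mulr_gt0 ?subr_gt0.
  lra.
have near_d : (c%:~R - d%:R * alpha) * b%:R < 1.
  have : 0 < (b%:R * alpha - a%:~R) * d%:R by rewrite mulr_gt0 ?subr_gt0.
  lra.
have [b_le_d|d_lt_b] := leqP b d.
  have b_le_dR : b%:R <= d%:R :> R by rewrite ler_nat.
  have dist_b : `|b%:R * alpha - a%:~R| = b%:R * alpha - a%:~R.
    by rewrite gtr0_norm ?subr_gt0.
  exists a, c, d%:Z, b; split.
  - rewrite ltnNge; apply/negP => b_le.
    have := far b a; rewrite b_gt0 b_le dist_b => /(_ isT); nra.
  - by rewrite -det; ring.
  - rewrite dist_b -div1r ler_pdivlMr //; apply/ltW/(le_lt_trans _ near_b).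
    by rewrite ler_wpM2l // subr_ge0 ltW.
have d_le_bR : d%:R <= b%:R :> R by rewrite ler_nat ltnW.
have dist_d : `|d%:R * alpha - c%:~R| = c%:~R - d%:R * alpha.
  by rewrite distrC gtr0_norm ?subr_gt0.
exists c, (- a), (- b%:Z), d; split.
- rewrite ltnNge; apply/negP => d_le.
  have := far d c; rewrite d_gt0 d_le dist_d => /(_ isT); nra.
- by rewrite -det; ring.
- rewrite dist_d -div1r ler_pdivlMr //; apply/ltW/(le_lt_trans _ near_d).
  by rewrite ler_wpM2l // subr_ge0 ltW.
Qed.

(** * Coprime solutions *)

(** The parameters are [r = a + i] and [t = b + j], where [a] is just above
    [q gamma] and [i, j < H], in the coordinates described above.  The origin [b] depends on
    [a] but not on [i], as the search takes place in a square. *)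
Lemma coprime_solution_of_size (R : realType) (alpha gamma : R) (p v : int)
    (q u L : nat) (H := (4 * L + 13)%N) :
  0 <= gamma -> (u < q)%N -> v * q%:Z - u%:Z * p = 1 ->
  `|q%:R * alpha - p%:~R| <= q%:R^-1 ->
  ((Num.truncn (q%:R * gamma)).+1 + H <= 2 ^ L)%N ->
  exists (m : int) (n : nat), [/\ coprimez m n, (q <= n <= (2 * H + 1) * q)%N
    & `|n%:R * alpha - m%:~R - gamma| <= (3 * H + 1)%:R / q%:R].
Proof.
move=> gamma_ge0 u_lt det close; set a := (Num.truncn _).+1 => size_a.
have q_gt0 : (0 < q)%N by apply: leq_ltn_trans u_lt.
(* As b q - a u lies in (H q, (H + 1) q], the number n = (b q - a u) + j q - i u
   lies between q and (2 H + 1) q. *)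
pose b := (a * u %/ q + H + 1)%N.
have [i [j [i_lt j_lt co_ij]]] :=
  exists_coprime_in_square L a b (ltn0Sn _) size_a.
set r := (a + i)%N in co_ij; set t := (b + j)%N in co_ij.
have n_low : (r * u + q <= t * q)%N.
  have := ltn_ceil (a * u) q_gt0; rewrite /r /t /b; move: i_lt.
  by rewrite -/H; nia.
have n_high : (t * q <= r * u + (2 * H + 1) * q)%N.
  have := leq_trunc_div (a * u) q; rewrite /r /t /b; move: j_lt.
  by rewrite -/H; nia.
pose n := (t * q - r * u)%N; pose m : int := t%:Z * p - r%:Z * v.
have nE : n%:Z = t%:Z * q%:Z - r%:Z * u%:Z by rewrite /n; lia.
have rE : n%:Z * p - m * q%:Z = r%:Z.
  by rewrite nE /m -[RHS]mulr1 -det; ring.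
have tE : n%:Z * v - m * u%:Z = t%:Z.
  by rewrite nE /m -[RHS]mulr1 -det; ring.
exists m, n; split.
- (* r and t are integer combinations of m and n: a Bezout relation between
     the former gives one between the latter. *)
  have /coprimezP[[x y] /= xy] : coprimez r%:Z t%:Z by [].
  apply/coprimezP; exists (- x * q%:Z - y * u%:Z, x * p + y * v) => /=.
  by rewrite -xy -rE -tE; ring.
- by rewrite /n; apply/andP; split; lia.
have q_gt0R : 0 < q%:R :> R by rewrite ltr0n.
rewrite ler_pdivlMr // -[X in _ * X](gtr0_norm q_gt0R) -normrM.
have rER : n%:R * p%:~R - m%:~R * q%:R = r%:R :> R.
  have /(congr1 (fun z : int => z%:~R : R)) := rE.
  by rewrite rmorphB !rmorphM.
have -> : (n%:R * alpha - m%:~R - gamma) * q%:R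
    = n%:R * (q%:R * alpha - p%:~R) + (r%:R - q%:R * gamma).
  by rewrite -rER; ring.
rewrite (le_trans (ler_normD _ _)) //.
have -> : (3 * H + 1)%:R = (2 * H + 1)%:R + H%:R :> R.
  by rewrite -natrD; congr (_%:R); lia.
apply: lerD.
  rewrite normrM ger0_norm // (le_trans (ler_wpM2l _ close)) //.
  by rewrite ler_pdivrMr // -natrM ler_nat /n; lia.
have qg_ge0 : 0 <= q%:R * gamma by rewrite mulr_ge0.
have /andP[tr_le tr_lt] := truncn_itv qg_ge0.
have rR : r%:R = a%:R + i%:R :> R by rewrite /r natrD.
have aR : a%:R = (Num.truncn (q%:R * gamma))%:R + 1 :> R by rewrite natr1.
have iR : i%:R + 1 <= H%:R :> R by rewrite natr1 ler_nat.
have i_ge0 : 0 <= i%:R :> R by [].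
rewrite -natr1 in tr_lt.
by rewrite ger0_norm; lra.
Qed.

(** With [z = ln n], the left-hand side is [O(z ^ 2)], while the right-hand side
    dominates the term of degree [6] of the exponential series at [c * sqrt z],
    which is a multiple of [z ^ 3]. *)
Lemma log_sqr_le_exp_sqrt_log (R : realType) (c K : R) : 0 < c ->
  exists N : nat, forall n : nat, (N <= n)%N ->
    K * (trunc_log 2 n).+1%:R ^+ 2 <= expR (c * Num.sqrt (ln n%:R)).
Proof.
move=> c_gt0; pose A : R := (ln 2)^-1 + 1; pose kappa : R := c ^+ 6 / 6`!%:R.
have ln2_gt0 : 0 < ln 2 :> R by rewrite ln_gt0 // ltr1n.
have kappa_gt0 : 0 < kappa by rewrite divr_gt0 ?exprn_gt0 // ltr0n fact_gt0.
pose T := Num.max 1 (`|K| * A ^+ 2 / kappa).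
exists (Num.truncn (expR T)).+1 => n n_ge.
have n_gt0 : (0 < n)%N by apply: leq_trans n_ge.
have T_le : T <= ln n%:R.
  rewrite -ler_expR lnK ?posrE ?ltr0n //.
  by apply/ltW/(lt_le_trans (truncnS_gt _)); rewrite ler_nat.
move: T_le; rewrite ge_max => /andP[z_ge1].
rewrite ler_pdivrMr // => z_large.
have l_le : (trunc_log 2 n).+1%:R <= A * ln n%:R.
  rewrite -natr1 mulrDl mul1r lerD // mulrC ler_pdivlMr // mulr_natl.
  rewrite -lnXn // -natrX ler_ln ?posrE ?ltr0n ?expn_gt0 //.
  by rewrite ler_nat trunc_logP.
set z := ln n%:R in z_ge1 z_large l_le *.
have z_ge0 : 0 <= z by lra.
apply: (@le_trans _ _ (kappa * z ^+ 3)).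
  apply: (@le_trans _ _ (`|K| * (A * z) ^+ 2)).
    apply: le_trans (ler_wpM2r (sqr_ge0 _) (ler_norm K)) _.
    by rewrite ler_wpM2l // ler_sqr ?nnegrE ?(le_trans _ l_le).
  have -> : `|K| * (A * z) ^+ 2 = `|K| * A ^+ 2 * z ^+ 2 by ring.
  have -> : kappa * z ^+ 3 = z * kappa * z ^+ 2 by ring.
  by rewrite ler_wpM2r ?sqr_ge0.
have cz_ge0 : 0 <= c * Num.sqrt z by rewrite mulr_ge0 ?sqrtr_ge0 ?ltW.
have := expR_ge1Dxn 5 cz_ge0.
rewrite exprMn (exprM (Num.sqrt z) 2 3) sqr_sqrtr // mulrAC -/kappa.
by move=> expR_ge; apply: le_trans expR_ge; rewrite lerDr.
Qed.

(** The error [(3 H + 1) / q] is at most [(3 H + 1) (2 H + 1) / n] since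
    [n <= (2 H + 1) q], and [H] can be taken linear in [log q <= log n]. *)
Lemma coprime_solution_beyond (R : realType) (c alpha gamma : R) (N : nat) :
  0 < c -> irrational alpha -> 0 <= gamma ->
  exists (m : int) (n : nat), [/\ (N < n)%N, coprimez m n
    & `|n%:R * alpha - m%:~R - gamma|
        <= expR (c * Num.sqrt (ln n%:R)) / n%:R].
Proof.
move=> c_gt0 irr gamma_ge0; pose G := (Num.truncn gamma).+1.
have gamma_lt : gamma < G%:R by exact: truncnS_gt.
(* C is such that (3 H + 1) (2 H + 1) <= C (l + 1) ^ 2, for the H and l below. *)
pose C := (6 * (4 * G + 54) ^ 2)%N.
have [N' growth] := log_sqr_le_exp_sqrt_log R c C%:R c_gt0.
have [p [v [q [u [q_large u_lt det close]]]]] :=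
  unimodular_approximation R alpha (N + N') irr.
have q_gt0 : (0 < q)%N by apply: leq_ltn_trans q_large.
(* 2 ^ L exceeds q * G, roughly 2 ^ l * G, by a wide margin, while L stays linear
   in l. *)
pose l := trunc_log 2 q; pose L := (2 * l + G + 10)%N.
have size_L : ((Num.truncn (q%:R * gamma)).+1 + (4 * L + 13) <= 2 ^ L)%N.
  have qgamma_lt : (Num.truncn (q%:R * gamma) < q * G)%N.
    rewrite truncn_lt_nat ?mulr_ge0 // natrM ltr_pM2l // ltr0n //.
  have qG_le : (q * G <= 2 ^ l.+1 * 2 ^ G)%N.
    by apply: leq_mul; rewrite ltnW // ?trunc_log_ltn // ltn_expl.
  have lG_lt := @ltn_expl 2 (l + G) isT.
  have -> : (2 ^ L = 2 ^ l * 2 ^ (l + G) * 1024)%N.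
    by rewrite -[1024%N]/(2 ^ 10)%N -!expnD; congr expn; rewrite /L; lia.
  have l_ge1 : (0 < 2 ^ l)%N by rewrite expn_gt0.
  move: qG_le; rewrite expnS -mulnA -expnD.
  by move: lG_lt qgamma_lt; rewrite /L; nia.
have [m [n [co_mn /andP[n_ge n_le] err]]] :=
  coprime_solution_of_size _ _ _ _ _ _ _ _ gamma_ge0 u_lt det close size_L.
have n_gt0 : (0 < n)%N by apply: leq_trans n_ge.
exists m, n; split=> //; first by lia.
apply: le_trans err _; have /growth exp_ge : (N' <= n)%N by lia.
set H := (4 * L + 13)%N in n_le *.
rewrite ler_pdivrMr ?ltr0n // mulrAC ler_pdivlMr ?ltr0n //.
apply: (@le_trans _ _ ((3 * H + 1) * (2 * H + 1) * q)%:R).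
  by rewrite -natrM ler_nat -mulnA leq_mul2l n_le orbT.
rewrite natrM ler_wpM2r //; apply: le_trans exp_ge.
rewrite -natrX -natrM ler_nat.
have l_le : (l <= trunc_log 2 n)%N by apply: leq_trunc_log.
apply: (@leq_trans (C * l.+1 ^ 2)%N); last first.
  by rewrite leq_mul2l leq_exp2r // ltnS l_le orbT.
have H_le : (H + 1 <= (4 * G + 54) * l.+1)%N by rewrite /H /L; lia.
apply: (@leq_trans (6 * (H + 1) ^ 2)%N); first by lia.
by rewrite /C -mulnA -expnMn leq_mul2l leq_exp2r.
Qed.

Theorem theorem1 (R : realType) (c : R) (hc : 2 * Num.sqrt (ln 2) < c)
    (alpha : R) (halpha : irrational alpha) (gamma : R) :
  infinite_set [set p : int * int |
    [/\ coprimez p.1 p.2, p.2 != 0 &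
        `|p.2%:~R * alpha - p.1%:~R - gamma|
          <= expR (c * Num.sqrt (ln `|p.2%:~R|)) / `|p.2%:~R| ]].
Proof.
have c_gt0 : 0 < c by apply: le_lt_trans hc; rewrite mulr_ge0 ?sqrtr_ge0.
suff unbounded (N : nat) : exists (m : int) (n : nat), [/\ (N < n)%N,
    coprimez m n & `|n%:R * alpha - m%:~R - gamma|
      <= expR (c * Num.sqrt (ln n%:R)) / n%:R].
  move=> /finite_seqP[s s_all].
  have [m [n [n_gt co_mn err]]] := unbounded (\max_(x <- s) `|x.2|)%N.
  have : (m, n%:Z) \in s.
    suff : [set` s] (m, n%:Z) by [].
    rewrite -s_all /=; split=> //; first by lia.
    by rewrite -!pmulrn normr_nat.
  move=> /(@leq_bigmax_seq _ _ xpredT (fun x => `|x.2|%N)) /(_ isT) /=.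
  by rewrite leqNgt n_gt.
have [gamma_ge0|gamma_lt0] := leP 0 gamma.
  exact: coprime_solution_beyond.
have irr_opp : irrational (- alpha).
  move=> [x _ x_alpha]; apply: halpha; exists (- x) => //.
  by rewrite rmorphN /= x_alpha opprK.
have [|m [n [n_gt co_mn err]]] :=
  coprime_solution_beyond R c (- alpha) (- gamma) N c_gt0 irr_opp.
  by rewrite oppr_ge0 ltW.
exists (- m), n; split=> //; first by rewrite coprimeNz.
apply: le_trans err; rewrite -normrN le_eqVlt; apply/orP; left; apply/eqP.
by congr (`|_|); rewrite rmorphN; ring.
Qed.
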